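(* The following two statements hold. (1) Let $M=\{M(t)\}_{t\ge 0}$ be a nonnegative submartingale or a nonnegative supermartingale on a filtered probability space $(\Omega,\mathcal{F},\{\mathcal{F}(t)\}_{t\ge 0},P)$. Let $\{M_n\}_{n\in\mathbb{N}}$, $M_n=\{M_n(t)\}_{t\ge 0}$, be a sequence of nonnegative martingales, each defined on a filtered probability space $(\Omega_n,\mathcal{F}_n,\{\mathcal{F}_n(t)\}_{t\ge 0},P_n)$, such that $M_n(0)=1$. Fix any sequence of deterministic times $\{t_m\}_{m\in\mathbb{N}}$ with $t_1=0$ and $\lim_{m\uparrow\infty}t_m=\infty$, and assume that $(P_n,M_n(t_m))\overset{\mathfrak{w}}{\Longrightarrow}(P,M(t_m))$ $(n\uparrow\infty)$ for each $m\in\mathbb{N}$. Define a family $\{Q_n^m\}_{n,m\in\mathbb{N}}$ of probability measures via $\mathrm{d}Q_n^m=M_n(t_m)\,\mathrm{d}P_n$. Then $M$ is a true martingale with $M(0)=1$ if and only if, for each $m\in\mathbb{N}$, $$\sup_{n\in\mathbb{N}}Q_n^m\bigl(M_n(t_m)\ge\kappa\bigr)\to 0\quad\text{as }\kappa\uparrow\infty ,$$ that is, if and only if $\{M_n(t_m)\}_{n\in\mathbb{N}}$ is tight under the sequence of measures $\{Q_n^m\}_{n\in\mathbb{N}}$ for each $m\in\mathbb{N}$. (2) Let $M(\infty)$ be a nonnegative random variable on a probability space $(\Omega,\mathcal{F},P)$ with expectation operator $E$, and let $\{M_n(\infty)\}_{n\in\mathbb{N}}$ be a sequence of nonnegative random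 variables, each defined on a probability space $(\Omega_n,\mathcal{F}_n,P_n)$ with expectation operator $E_n$, such that $E_n[M_n(\infty)]=1$. Assume that $(P_n,M_n(\infty))\overset{\mathfrak{w}}{\Longrightarrow}(P,M(\infty))$ $(n\uparrow\infty)$. Define a family $\{Q_n\}_{n\in\mathbb{N}}$ of probability measures via $\mathrm{d}Q_n=M_n(\infty)\,\mathrm{d}P_n$. Then $E[M(\infty)]=1$ holds if and only if $$\sup_{n\in\mathbb{N}}Q_n\bigl(M_n(\infty)\ge\kappa\bigr)\to 0\quad\text{as }\kappa\uparrow\infty .$$
   Context: For (real-valued) random variables $Y_n$ defined on probability spaces $(\Omega_n,\mathcal{F}_n,P_n)$, $n\in\mathbb{N}$, and a random variable $Y$ defined on $(\Omega,\mathcal{F},P)$, the notation $(P_n,Y_n)\overset{\mathfrak{w}}{\Longrightarrow}(P,Y)$ $(n\uparrow\infty)$ means that $\lim_{n\uparrow\infty}P_n(Y_n\le x)=P(Y\le x)$ for each continuity point $x$ of $P(Y\le\cdot)$ (convergence in distribution). *)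

(* Defs.v *)
From mathcomp Require Export all_boot all_order all_algebra.
From mathcomp Require Export all_classical all_reals all_analysis.
Export Order.TTheory GRing.Theory Num.Theory.
Export numFieldNormedType.Exports.

Set Implicit Arguments.
Unset Strict Implicit.
Unset Printing Implicit Defensive.

Local Open Scope classical_set_scope.
Local Open Scope ring_scope.

Definition cvg_in_distribution (R : realType)
    (dn : nat -> measure_display) (Tn : forall n, measurableType (dn n))
    (Pn : forall n, probability (Tn n) R) (Yn : forall n, {RV (Pn n) >-> R})
    (d : measure_display) (T : measurableType d) (P : probability T R)
    (Y : {RV P >-> R}) : Prop :=
  forall x : R, {for x, continuous (cdf Y)} ->
    cdf (Yn n) x @[n --> \oo] --> cdf Y x.

(* [dQ = Z dP] *)
Definition has_density (R : realType) (d : measure_display)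
    (T : measurableType d) (P Q : probability T R) (Z : T -> R) : Prop :=
  forall A : set T, measurable A -> Q A = (\int[P]_(w in A) (Z w)%:E)%E.

(* Inner regularity by compact sets, uniformly over laws [Q n \o X n ^-1]. *)
Definition tight (R : realType)
    (dn : nat -> measure_display) (Tn : forall n, measurableType (dn n))
    (Q : forall n, probability (Tn n) R) (X : forall n, Tn n -> R) : Prop :=
  forall e : R, 0 < e ->
    exists2 K : set R, compact K &
      forall n, (Q n [set w | ~ K (X n w)] <= e%:E)%E.

Section martingales.
Context (R : realType) (d : measure_display) (T : measurableType d).
Implicit Types (P : probability T R) (G : set_system T) (X Y : T -> R).
Implicit Types (F : {nonneg R} -> set_system T) (M : {nonneg R} -> T -> R).

Definition filtration F : Prop :=
  [/\ forall t, sigma_algebra setT (F t),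
      forall t, F t `<=` measurable &
      forall s t, s <= t -> F s `<=` F t].

Definition measurable_wrt G X : Prop :=
  preimage_set_system setT X measurable `<=` G.

(* [Y] is a version of the conditional expectation E_P[X | G]; [X] is meant to
   be P-integrable. *)
Definition is_cond_exp P G X Y : Prop :=
  [/\ measurable_wrt G Y,
      P.-integrable setT (EFin \o Y) &
      forall A, G A ->
        (\int[P]_(w in A) (Y w)%:E = \int[P]_(w in A) (X w)%:E)%E].

Definition adapted_integrable P F M : Prop :=
  forall t, measurable_wrt (F t) (M t) /\ P.-integrable setT (EFin \o M t).

Definition martingale P F M : Prop :=
  adapted_integrable P F M /\
  forall s t, s <= t ->
    exists2 Y, is_cond_exp P (F s) (M t) Y & {ae P, forall w, Y w = M s w}.

Definition submartingale P F M : Prop :=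
  adapted_integrable P F M /\
  forall s t, s <= t ->
    exists2 Y, is_cond_exp P (F s) (M t) Y & {ae P, forall w, M s w <= Y w}.

Definition supermartingale P F M : Prop :=
  adapted_integrable P F M /\
  forall s t, s <= t ->
    exists2 Y, is_cond_exp P (F s) (M t) Y & {ae P, forall w, Y w <= M s w}.

End martingales.

(* Main.v *)
From HB Require Import structures.
From mathcomp Require Import measurable_realfun lra.
Require Import Defs.

(** Let X_n be a density of Q_n with respect to P_n, so that X_n has mean 1,
    and let X_n converge in distribution to Y. Weak convergence alone gives
    convergence of the means truncated at any level k
    ([cvg_in_distribution_clip_integral]), because a truncated mean is the
    integral over [0, k[ of the tail function. The mean of Y is therefore at
    most 1, and it equals 1 exactly when no mass of the X_n escapes to
    infinity. The mass that Q_n puts above a level is, up to a factor 2 in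
    both the level and the mass, the part of the mean that truncation loses
    ([density_tail_le] and [clip_integral_ge]). Hence the mean of Y is 1 if
    and only if the tails under Q_n are uniformly small ([expectation_eq1P]),
    which is statement (2).

    For statement (1), apply this at each time t_m: the tail conditions say
    that M(t_m) has mean 1 for all m. A martingale started at 1 has mean 1 at
    all times. Conversely, the mean of a submartingale or supermartingale is
    monotone in time, so if it is 1 at t_0 = 0 and along a sequence of times
    tending to infinity, it is 1 throughout ([expectation_between]); a
    submartingale or supermartingale of constant mean is a martingale
    ([martingale_of_expectation]). Finally M(0) is the limit in distribution
    of the constants 1 and has mean 1, which forces M(0) = 1 almost surely
    ([cvg_in_distribution_eq1]). Tightness of the M_n(t_m) under the Q_n^m is
    the same tail condition because compact sets are bounded ([tightP]). *)

Set Implicit Arguments.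
Unset Strict Implicit.
Unset Printing Implicit Defensive.

Local Open Scope classical_set_scope.
Local Open Scope ring_scope.

(** * Truncation and convergence in distribution *)

Definition clip (R : realType) (k x : R) : R := Num.max 0 (Num.min x k).

Section clip.
Context {R : realType}.
Implicit Types k x : R.

Lemma clip_ge0 k x : 0 <= clip k x.
Proof. by rewrite /clip le_max lexx. Qed.

Lemma clip_le k x : 0 <= x -> clip k x <= x.
Proof. by move=> x0; rewrite /clip ge_max x0 ge_min lexx. Qed.

Lemma clip_le_norm k x : clip k x <= `|x|.
Proof. by rewrite /clip ge_max normr_ge0 ge_min ler_norm. Qed.

Lemma clip_le_bound k x : 0 <= k -> clip k x <= k.
Proof. by move=> k0; rewrite /clip ge_max k0 ge_min lexx orbT. Qed.

Lemma clip_id k x : 0 <= x <= k -> clip k x = x.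
Proof. by move=> /andP[x0 xk]; rewrite /clip min_l// max_r. Qed.

Lemma le_clip k l x : k <= l -> clip k x <= clip l x.
Proof.
move=> kl; rewrite /clip ge_max !le_max lexx/=; apply/orP; right.
by rewrite le_min !ge_min lexx kl orbT.
Qed.

Lemma lt_clip r k x : 0 <= r -> (r < clip k x) = (r < x) && (r < k).
Proof. by move=> r0; rewrite /clip lt_max lt_min ltNge r0. Qed.

Lemma measurable_clip k : measurable_fun [set: R] (clip k).
Proof.
apply: measurable_maxr; first exact: measurable_cst.
by apply: measurable_minr; [exact: measurable_id|exact: measurable_cst].
Qed.

HB.instance Definition _ k :=
  isMeasurableFun.Build _ _ _ _ (clip k) (measurable_clip k).

End clip.

Section clip_moment.
Context (R : realType) (d : measure_display) (T : measurableType d).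
Variables (P : probability T R) (X : {RV P >-> R}).

Lemma measurable_clip_comp k :
  measurable_fun [set: T] (fun w => (clip k (X w))%:E).
Proof.
by apply/measurable_EFinP; exact: (measurableT_comp (measurable_clip k)).
Qed.

Lemma clip_integrable k : P.-integrable setT (EFin \o X) ->
  P.-integrable setT (fun w => (clip k (X w))%:E).
Proof.
apply: le_integrable => //; first exact: measurable_clip_comp.
by move=> w _ /=; rewrite lee_fin ger0_norm ?clip_ge0// clip_le_norm.
Qed.

(** This is what makes truncated means computable from the distribution
    function: on [0, k[ the event r < clip k X is r < X, and beyond k it is
    empty, so the tail formula for clip k X only sees the tails of X. *)
Lemma clip_integral_ccdf k :
  (\int[P]_w (clip k (X w))%:E =
   \int[lebesgue_measure]_(r in `[0%R, k[) ccdf X r)%E.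
Proof.
pose Y : {RV P >-> R} := clip k \o X.
have := @ge0_expectation_ccdf _ _ _ P Y (fun w => clip_ge0 k (X w)).
rewrite expectation_def => ->.
rewrite [LHS]integral_mkcond [RHS]integral_mkcond; apply: eq_integral => r _.
rewrite !patchE !mem_setE !in_itv/= andbT.
case: (leP 0 r) => //= r0; rewrite /ccdf /distribution /pushforward.
case: ltP => [rk|kr].
  congr (P _); apply/seteqP; split => w /=; rewrite !in_itv/= !andbT;
    by rewrite lt_clip// rk andbT.
transitivity (P set0); last exact: measure0.
congr (P _); apply/seteqP; split => w //=.
by rewrite !in_itv/= !andbT lt_clip// [r < k]ltNge kr andbF.
Qed.

Lemma cvg_clip_integral : {ae P, forall w, 0 <= X w} ->
  (\int[P]_w (clip n%:R (X w))%:E @[n --> \oo] --> \int[P]_w (X w)%:E)%E.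
Proof.
move=> X0.
have -> : (\int[P]_w (X w)%:E =
    \int[P]_w (limn (fun n => (clip n%:R (X w))%:E)))%E.
  have lim0 w : limn (fun n => (clip n%:R (X w))%:E) = (Num.max 0 (X w))%:E.
    apply/cvg_lim => //; apply: cvg_near_cst.
    exists (Num.truncn (X w)).+1 => // n /= Xn; rewrite /clip min_l//.
    by rewrite (le_trans (ltW (truncnS_gt _)))// ler_nat.
  under [RHS]eq_integral do rewrite lim0.
  apply: ae_eq_integral => //.
  - exact/measurable_EFinP.
  - by apply/measurable_EFinP; apply: measurable_maxr.
  - by move: X0; apply: filterS => w Xw _; rewrite max_r.
apply: cvg_monotone_convergence => //.
- by move=> n; exact: measurable_clip_comp.
- by move=> n w _; rewrite lee_fin clip_ge0.
- by move=> w _ m n mn; rewrite lee_fin le_clip// ler_nat.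
Qed.

(** A monotone function has countably many jumps. Right continuity of the
    distribution function identifies its right limit with its value, so every
    point of discontinuity is a jump. *)
Lemma ae_continuous_cdf :
  {ae lebesgue_measure, forall r, {for r, continuous (cdf X)}}.
Proof.
pose F r := fine (cdf X r).
have FE r : cdf X r = (F r)%:E by rewrite /F fineK// fin_num_measure.
have F_nd : {homo F : x y / x <= y}.
  by move=> x y xy; rewrite -lee_fin -!FE; exact: cdf_nondecreasing.
have F_le1 y : F y <= 1 by rewrite -lee_fin -FE cdf_le1.
pose D := \bigcup_n [set x | x \in (`]- n%:R, n%:R[) /\ discontinuity F x].
have cD : countable D.
  apply: bigcup_countable => [|n _]; first exact: countableP.
  by apply: discontinuity_countable => x y _ _; exact: F_nd.
exists D; split.
- exact: countable_measurable.
- exact: countable_lebesgue_measure0.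
move=> x /= Fx.
(* Any interval containing x will do: the jumps are counted on ]-n, n[. *)
exists (Num.truncn `|x|).+1 => //=; split.
  by rewrite in_itv/= -ltr_norml truncnS_gt.
have Fr : F y @[y --> x^'+] --> F x.
  by apply: fine_cvg; rewrite -FE; exact: cdf_right_continuous.
have cFl : cvg (F y @[y --> x^'-]).
  apply: nondecreasing_at_left_is_cvgr.
  - by near=> z => u v _ _; exact: F_nd.
  - by near=> z; exists 1 => _ [y _ <-].
split => //; first by apply/cvg_ex; exists (F x).
rewrite (cvg_lim _ Fr)//; apply/eqP => FlE; apply: Fx.
have Fc : F y @[y --> x] --> F x.
  by apply/left_right_continuousP; split => //; rewrite -FlE.
rewrite /prop_for /continuous_at FE.
by apply: cvg_EFin => //; apply: nearW => y; rewrite fin_num_measure.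
Unshelve. all: by end_near. Qed.

End clip_moment.

(** Truncated means pass to the limit in distribution: they are integrals of
    tail functions over the bounded interval [0, k[, the tail functions are
    bounded by 1, and they converge at the continuity points of the limit, hence
    Lebesgue almost everywhere. *)
Lemma cvg_in_distribution_clip_integral (R : realType)
    (dn : nat -> measure_display) (Tn : forall n, measurableType (dn n))
    (Pn : forall n, probability (Tn n) R) (Xn : forall n, {RV (Pn n) >-> R})
    (d : measure_display) (T : measurableType d) (P : probability T R)
    (X : {RV P >-> R}) (k : R) :
  cvg_in_distribution Xn X ->
  (\int[Pn n]_w (clip k (Xn n w))%:E @[n --> \oo] -->
   \int[P]_w (clip k (X w))%:E)%E.
Proof.
move=> XnX; rewrite clip_integral_ccdf.
under eq_fun do rewrite clip_integral_ccdf.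
have [] // := @dominated_convergence _ _ _ lebesgue_measure `[0%R, k[%classic _
  (fun n r => ccdf (Xn n) r) (ccdf X) (cst 1%E).
- by move=> n; apply: measurable_funTS; exact: ccdf_measurable.
- by apply: measurable_funTS; exact: ccdf_measurable.
- apply: (@filterS _ _ (ae_filter_ringOfSetsType lebesgue_measure) _ _ _
    (ae_continuous_cdf X)) => r cXr _.
  rewrite ccdf_1_cdf; under eq_fun do rewrite ccdf_1_cdf.
  apply: cvgeB; [by rewrite fin_num_adde_defr|exact: cvg_cst|exact: XnX].
- apply/integrableP; split => //.
  under eq_integral do rewrite abse1.
  rewrite integral_cst// mul1e /= lebesgue_measure_itv/=.
  by case: ifP => // _; rewrite -EFinB ltry.
- apply: aeW => r n _ /=; by rewrite gee0_abs// probability_le1.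
Qed.

(** * Means of almost surely ordered functions *)

Section ae_integral.
Context (R : realType) (d : measure_display) (T : measurableType d).
Variable (P : probability T R).

Lemma ae_ge0_integral_norm (X : T -> R) : measurable_fun setT X ->
  {ae P, forall w, 0 <= X w} ->
  (\int[P]_w `|X w|%:E = \int[P]_w (X w)%:E)%E.
Proof.
move=> mX X0; apply: ae_eq_integral => //.
- by apply/measurable_EFinP; exact: measurableT_comp.
- exact/measurable_EFinP.
- by move: X0; apply: filterS => w Xw _; rewrite ger0_norm.
Qed.

(** The common source of the next two lemmas: comparing, and in the equality
    case identifying, two almost surely ordered functions through their means. *)
Lemma ae_le_integral_norm_sub (X Y : T -> R) :
  P.-integrable setT (EFin \o X) -> P.-integrable setT (EFin \o Y) ->
  {ae P, forall w, X w <= Y w} ->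
  (\int[P]_w `|Y w - X w|%:E = \int[P]_w (Y w)%:E - \int[P]_w (X w)%:E)%E.
Proof.
move=> iX iY XY; rewrite ae_ge0_integral_norm; last 2 first.
- by apply: measurable_funB; apply/measurable_EFinP;
    [exact: measurable_int iY|exact: measurable_int iX].
- by move: XY; apply: filterS => w; rewrite subr_ge0.
by under eq_integral do rewrite EFinB; rewrite integralB_EFin.
Qed.

Lemma ae_le_integral (X Y : T -> R) :
  P.-integrable setT (EFin \o X) -> P.-integrable setT (EFin \o Y) ->
  {ae P, forall w, X w <= Y w} ->
  (\int[P]_w (X w)%:E <= \int[P]_w (Y w)%:E)%E.
Proof.
move=> iX iY XY; rewrite -sube_ge0; last by rewrite integrable_fin_num ?orbT.
by rewrite -ae_le_integral_norm_sub// integral_ge0.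
Qed.

Lemma ae_eq_of_le_integral (X Y : T -> R) :
  P.-integrable setT (EFin \o X) -> P.-integrable setT (EFin \o Y) ->
  {ae P, forall w, X w <= Y w} ->
  (\int[P]_w (X w)%:E = \int[P]_w (Y w)%:E)%E ->
  {ae P, forall w, X w = Y w}.
Proof.
move=> iX iY XY EXY.
have mYX : measurable_fun setT (fun w => (Y w - X w)%:E).
  apply/measurable_EFinP.
  by apply: measurable_funB; apply/measurable_EFinP;
    [exact: measurable_int iY|exact: measurable_int iX].
have := ae_le_integral_norm_sub iX iY XY.
rewrite EXY subee ?integrable_fin_num//.
move=> /(ae_eq_integral_abs P measurableT mYX).
by apply: filterS => w /(_ I) [] /eqP; rewrite subr_eq0 eq_sym => /eqP.
Qed.

End ae_integral.

(** * Truncated means and the tails of a density *)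

Section density_tail.
Context (R : realType) (d : measure_display) (T : measurableType d).
Variables (P Q : probability T R) (X : {RV P >-> R}).
Hypothesis X0 : {ae P, forall w, 0 <= X w}.

Lemma clip_integral_le k :
  (\int[P]_w (clip k (X w))%:E <= \int[P]_w (X w)%:E)%E.
Proof.
rewrite -(ae_ge0_integral_norm _ X0)//.
apply: ge0_le_integral => //.
- by move=> w _; rewrite lee_fin clip_ge0.
- exact: measurable_clip_comp.
- by apply/measurable_EFinP; exact: measurableT_comp.
- by move=> w _; rewrite lee_fin clip_le_norm.
Qed.

Hypothesis QX : has_density P Q X.

Lemma density_expectation : (\int[P]_w (X w)%:E = 1)%E.
Proof. by rewrite -(QX measurableT) probability_setT. Qed.

Lemma density_integrable : P.-integrable setT (EFin \o X).
Proof.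
apply/integrableP; split; first exact/measurable_EFinP.
have -> : (\int[P]_x `|(EFin \o X) x| = \int[P]_x `|X x|%:E)%E by [].
by rewrite (ae_ge0_integral_norm _ X0)// density_expectation ltry.
Qed.

Lemma measurable_tail (k : R) : measurable [set w | (k <= X w)%R].
Proof.
rewrite [X in measurable X](_ : _ = X @^-1` `[k, +oo[).
  exact: measurable_funPTI.
by apply/seteqP; split => w /=; rewrite in_itv/= andbT.
Qed.

Lemma measurable_lt0 : measurable [set w | X w < 0].
Proof.
rewrite [X in measurable X](_ : _ = X @^-1` `]-oo, 0[).
  exact: measurable_funPTI.
by apply/seteqP; split => w /=; rewrite in_itv.
Qed.

(** If truncating at k loses little of the mean, the tail beyond 2 k has little
    Q-mass: where X >= 2 k, the lost part X - k is at least X / 2, so the Q-mass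
    of that tail is at most twice the loss 1 - E[clip k X]. *)
Lemma density_tail_le (e k l : R) : 0 < k -> 2 * k <= l ->
  (1 - (e / 2)%:E <= \int[P]_w (clip k (X w))%:E)%E ->
  (Q [set w | (l <= X w)%R] <= e%:E)%E.
Proof.
move=> k0 kl; have mA := measurable_tail l.
have mB : measurable_fun setT (fun w => `|X w - clip k (X w)|).
  apply: measurableT_comp => //; apply: measurable_funB => //.
  exact: (measurableT_comp (measurable_clip k)).
have QA : (Q [set w | (l <= X w)%R] <=
    2%:E * \int[P]_w `|X w - clip k (X w)|%:E)%E.
  rewrite QX// -ge0_integralZl_EFin//; last exact/measurable_EFinP.
  apply: (@le_trans _ _
      (\int[P]_(w in [set w | (l <= X w)%R]) (2 * `|X w - clip k (X w)|)%:E)%E).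
    apply: ge0_le_integral => //.
    - by move=> w /= lX; rewrite lee_fin; lra.
    - by apply/measurable_EFinP; exact: measurable_funTS.
    - apply/measurable_EFinP; apply: measurable_funTS.
      by apply: measurable_funM.
    - move=> w /= lX; rewrite lee_fin; have := ler_norm (X w - clip k (X w)).
      by have := clip_le_bound (X w) (ltW k0); lra.
  apply: ge0_subset_integral => //.
  - by apply/measurable_EFinP; apply: measurable_funM.
have iX := density_integrable; have ic := clip_integrable k iX.
rewrite ae_le_integral_norm_sub// in QA; last first.
  by move: X0; apply: filterS => w; exact: clip_le.
move: QA; rewrite density_expectation.
have : (\int[P]_w (clip k (X w))%:E)%E \is a fin_num.
  by rewrite integrable_fin_num.
case: (\int[P]_w _)%E => // c _ QA; rewrite -EFinB lee_fin => ec.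
by apply: (le_trans QA); rewrite -EFinB -EFinM lee_fin; lra.
Qed.

(** Conversely, the truncated mean keeps at least the Q-mass of X < k, since X
    and clip k X agree there. *)
Lemma clip_integral_ge (e k : R) : (Q [set w | (k <= X w)%R] <= e%:E)%E ->
  (1 - e%:E <= \int[P]_w (clip k (X w))%:E)%E.
Proof.
move=> Qe; have mA := measurable_tail k.
apply: (@le_trans _ _ (Q (~` [set w | (k <= X w)%R]))).
  by rewrite probability_setC// leeB.
rewrite QX; last exact: measurableC.
rewrite (_ : (\int[P]_(w in ~` [set w | (k <= X w)%R]) (X w)%:E =
  \int[P]_(w in ~` [set w | (k <= X w)%R]) (clip k (X w))%:E)%E); last first.
  apply: ae_eq_integral; first exact: measurableC.
  - by apply/measurable_EFinP; exact: measurable_funTS.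
  - by apply: measurable_funTS; exact: measurable_clip_comp.
  - move: X0; apply: filterS => w Xw /= /negP; rewrite -ltNge => /ltW Xk.
    by rewrite clip_id// Xw.
apply: ge0_subset_integral => //.
- exact: measurableC.
- exact: measurable_clip_comp.
- by move=> w _; rewrite lee_fin clip_ge0.
Qed.

Lemma density_lt0 : Q [set w | X w < 0] = 0%E.
Proof.
have mN := measurable_lt0.
rewrite QX//; apply: null_set_integral => //.
  by apply/measurable_EFinP; exact: measurable_funTS.
apply: measure_negligible => //.
move: X0; rewrite /almost_everywhere/=; apply: negligibleS => w /= + Xw.
by rewrite ltNge Xw.
Qed.

End density_tail.

(** * Uniformly small tails *)

Lemma cvge_near_gt (R : realFieldType) (I : Type) (F : set_system I)
    {FF : Filter F} (f : I -> \bar R) (a b : \bar R) :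
  (b < a)%E -> f i @[i --> F] --> a -> \forall i \near F, (b < f i)%E.
Proof. by move=> ba fa; exact: (fa _ (open_ereal_gt' ba)). Qed.

Lemma cvge_near_lt (R : realFieldType) (I : Type) (F : set_system I)
    {FF : Filter F} (f : I -> \bar R) (a b : \bar R) :
  (a < b)%E -> f i @[i --> F] --> a -> \forall i \near F, (f i < b)%E.
Proof. by move=> ba fa; exact: (fa _ (open_ereal_lt' ba)). Qed.

(** The epsilon form shared by the vanishing of the suprema of tail masses and
    by tightness; under densities X n, it is the uniform integrability of the
    X n. *)
Definition uniform_tails (R : realType)
    (dn : nat -> measure_display) (Tn : forall n, measurableType (dn n))
    (Q : forall n, probability (Tn n) R) (X : forall n, Tn n -> R) : Prop :=
  forall e : R, 0 < e ->
    exists l : R, forall n, (Q n [set w | (l <= X n w)%R] <= e%:E)%E.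

Section uniform_tails.
Context (R : realType) (dn : nat -> measure_display).
Context (Tn : forall n, measurableType (dn n)).
Variables (Pn Q : forall n, probability (Tn n) R).
Variable X : forall n, {RV (Pn n) >-> R}.
Hypothesis X0 : forall n, {ae Pn n, forall w, 0 <= X n w}.
Hypothesis QX : forall n, has_density (Pn n) (Q n) (X n).

Lemma le_tail n (k l : R) : k <= l ->
  (Q n [set w | (l <= X n w)%R] <= Q n [set w | (k <= X n w)%R])%E.
Proof.
move=> kl; apply: le_measure; rewrite ?inE; [exact: measurable_tail..|].
by move=> w /=; exact: le_trans.
Qed.

(** A tail bound at one level persists at all higher levels, because tail masses
    decrease in the level; hence the limit of the suprema only requires one level
    per epsilon. *)
Lemma ereal_sup_tail_cvg0P :
  ereal_sup (range (fun n => Q n [set w | l <= X n w])) @[l --> +oo] --> 0%E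
  <-> uniform_tails Q X.
Proof.
split=> [sup0 e e0|ut].
  have : \forall l \near +oo,
      (ereal_sup (range (fun n => Q n [set w | (l <= X n w)%R])) < e%:E)%E.
    by apply: cvge_near_lt sup0; rewrite lte_fin.
  move=> /filter_ex[l le]; exists l => n.
  by apply: le_trans (ltW le); apply: ereal_sup_ubound; exists n.
have sup_ge0 (l : R) :
    (0 <= ereal_sup (range (fun n => Q n [set w | (l <= X n w)%R])))%E.
  apply: (@le_trans _ _ (Q 0%N [set w | (l <= X 0%N w)%R])) => //.
  by apply: ereal_sup_ubound; exists 0%N.
have sup_le (e : R) : 0 < e -> \forall l \near +oo,
    (ereal_sup (range (fun n => Q n [set w | (l <= X n w)%R])) <= e%:E)%E.
  move=> /ut[k ke]; near=> l; apply: ge_ereal_sup => _ [n _ <-].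
  apply: le_trans (ke n); apply: le_tail.
  by near: l; apply: nbhs_pinfty_ge; rewrite num_real.
apply/fine_cvgP; split.
  apply: filterS (sup_le 1 ltr01) => l l1.
  by rewrite ge0_fin_numE// (le_lt_trans l1)// ltry.
apply/cvgr0Pnorm_le => e e0; apply: filterS (sup_le e e0) => l le /=.
rewrite ger0_norm ?fine_ge0//.
by rewrite -lee_fin fineK// ge0_fin_numE// (le_lt_trans le)// ltry.
Unshelve. all: by end_near. Qed.

(** Compact subsets of the line are bounded, and conversely [0, l] is compact.
    Discarding the negative half-line costs nothing, since Q n has a density that
    is almost surely nonnegative and hence puts no mass on X n < 0. *)
Lemma tightP : tight Q X <-> uniform_tails Q X.
Proof.
split=> [tQ e e0|uQ e e0].
  have [K cK Ke] := tQ e e0.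
  have [M [_ KM]] := compact_bounded cK.
  exists (M + 1 + 1) => n; apply: le_trans (Ke n); apply: le_measure.
  - by rewrite inE; exact: measurable_tail.
  - rewrite inE (_ : [set w | _] = X n @^-1` (~` K))//.
    apply: measurable_funPTI; apply: measurableC; apply: closed_measurable.
    exact: compact_closed.
  move=> w /= MX KX; have := KM (M + 1) _ _ KX; rewrite /= ltrDl ltr01.
  by move=> /(_ isT); have := ler_norm (X n w); lra.
have [l le] := uQ e e0.
exists `[0, l]%classic; first exact: segment_compact.
move=> n; rewrite (_ : [set w | _] =
    [set w | X n w < 0] `|` [set w | l < X n w]); last first.
  apply/seteqP; split => w /=; rewrite in_itv/=.
    by move/negP; rewrite negb_and -!ltNge => /orP.
  by move=> H; apply/negP; rewrite negb_and -!ltNge; apply/orP.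
have ml : measurable [set w | l < X n w].
  rewrite [Y in measurable Y](_ : _ = X n @^-1` `]l, +oo[).
    exact: measurable_funPTI.
  by apply/seteqP; split => w /=; rewrite in_itv/= andbT.
apply: (@le_trans _ _
    (Q n [set w | (X n w < 0)%R] + Q n [set w | (l < X n w)%R])%E).
  by apply: measureU2 => //; exact: measurable_lt0.
rewrite (density_lt0 (X0 n) (@QX n)) add0e; apply: le_trans (le n).
by apply: le_measure; rewrite ?inE//; [exact: measurable_tail|move=> w /= /ltW].
Qed.

(** No mass escapes to infinity exactly when the limit has mean 1. Both
    directions compare means truncated at a level k, for which convergence in
    distribution suffices. *)
Lemma expectation_eq1P (d : measure_display) (T : measurableType d)
    (P : probability T R) (Y : {RV P >-> R}) :
  {ae P, forall w, 0 <= Y w} -> cvg_in_distribution X Y ->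
  (\int[P]_w (Y w)%:E = 1)%E <-> uniform_tails Q X.
Proof.
move=> Y0 XY; have cY := cvg_clip_integral Y0.
split=> [Y1 e e0|ut].
  (* e / 2 because the tail bound loses a factor 2. *)
  have lt1 : (1 - (e / 2)%:E < 1 :> \bar R)%E by rewrite -EFinB lte_fin; lra.
  rewrite Y1 in cY.
  have [K KY] := filter_ex (cvge_near_gt lt1 cY).
  have [N _ NX] :=
    cvge_near_gt KY (cvg_in_distribution_clip_integral (k := K%:R) XY).
  have kX n : exists k : nat,
      (1 - (e / 2)%:E < \int[Pn n]_w (clip k%:R (X n w))%:E)%E.
    have cX := cvg_clip_integral (X0 n).
    rewrite (density_expectation (@QX n)) in cX.
    exact: filter_ex (cvge_near_gt lt1 cX).
  have [k_ k_P] := choice kX.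
  (* Convergence controls the means truncated at K only for n >= N; the finitely
     many remaining variables have their own levels, and k dominates them all. *)
  pose k := (K + \max_(n < N) k_ n).+1.
  exists (2 * k%:R) => n.
  apply: (density_tail_le (X0 n) (@QX n) (k := k%:R)) => //.
  have clipk (m : nat) : (m <= k)%N ->
      (1 - (e / 2)%:E < \int[Pn n]_w (clip m%:R (X n w))%:E)%E ->
      (1 - (e / 2)%:E <= \int[Pn n]_w (clip k%:R (X n w))%:E)%E.
    move=> mk mP; apply: (le_trans (ltW mP)); apply: ge0_le_integral => //.
    - by move=> w _; rewrite lee_fin clip_ge0.
    - exact: measurable_clip_comp.
    - exact: measurable_clip_comp.
    - by move=> w _; rewrite lee_fin le_clip// ler_nat.
  have [Nn|nN] := leqP N n.
    by apply: (clipk K); [rewrite /k ltnW// ltnS leq_addr|exact: NX].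
  apply: (clipk (k_ n)); last exact: k_P.
  rewrite /k ltnW// ltnS (leq_trans _ (leq_addl _ _))//.
  exact: (leq_bigmax (Ordinal nN)).
apply/eqP; rewrite eq_le; apply/andP; split.
  apply: cvge_to_le cY _; apply: nearW => k.
  apply: cvge_to_le (cvg_in_distribution_clip_integral (k := k%:R) XY) _.
  apply: nearW => n; rewrite -(density_expectation (@QX n)).
  exact: clip_integral_le.
apply/lee_subgt0Pr => e e0; have [l le] := ut e e0.
apply: cvge_to_ge cY _; near=> k.
apply: cvge_to_ge (cvg_in_distribution_clip_integral (k := k%:R) XY) _.
apply: nearW => n; apply: (clip_integral_ge (X0 n) (@QX n)).
apply: le_trans (le n); apply: le_tail.
by near: k; exact: nbhs_infty_ger.
Unshelve. all: by end_near. Qed.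

End uniform_tails.

(** * Submartingales and supermartingales of constant mean *)

Section constant_expectation.
Context (R : realType) (d : measure_display) (T : measurableType d).
Variables (P : probability T R) (F : {nonneg R} -> set_system T).
Variable (M : {nonneg R} -> {RV P >-> R}).
Hypothesis filF : filtration F.

Lemma is_cond_exp_expectation s (X Y : T -> R) : is_cond_exp P (F s) X Y ->
  (\int[P]_w (Y w)%:E = \int[P]_w (X w)%:E)%E.
Proof.
case=> _ _; apply; case: filF => /(_ s)[F0 FC _] _ _.
by rewrite -(setD0 setT); exact: FC.
Qed.

Lemma martingale_expectation s t : martingale P F M -> s <= t ->
  (\int[P]_w (M s w)%:E = \int[P]_w (M t w)%:E)%E.
Proof.
move=> [aM cM] st; have [Y cY YM] := cM _ _ st.
rewrite -(is_cond_exp_expectation cY); apply: ae_eq_integral => //.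
- exact/measurable_EFinP.
- by case: cY => _ iY _; exact: measurable_int iY.
- by move: YM; apply: filterS => w ->.
Qed.

Lemma submartingale_expectation s t : submartingale P F M -> s <= t ->
  (\int[P]_w (M s w)%:E <= \int[P]_w (M t w)%:E)%E.
Proof.
move=> [aM cM] st; have [Y cY YM] := cM _ _ st.
rewrite -(is_cond_exp_expectation cY); apply: ae_le_integral YM.
  by have [] := aM s.
by case: cY.
Qed.

Lemma supermartingale_expectation s t : supermartingale P F M -> s <= t ->
  (\int[P]_w (M t w)%:E <= \int[P]_w (M s w)%:E)%E.
Proof.
move=> [aM cM] st; have [Y cY YM] := cM _ _ st.
rewrite -(is_cond_exp_expectation cY); apply: ae_le_integral YM.
  by case: cY.
by have [] := aM s.
Qed.

(** A one-sided conditional inequality between functions of equal mean is an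
    almost sure equality. *)
Lemma martingale_of_expectation (c : \bar R) :
  submartingale P F M \/ supermartingale P F M ->
  (forall s, \int[P]_w (M s w)%:E = c)%E -> martingale P F M.
Proof.
move=> sM Mc; split; first by case: sM => -[].
move=> s t st; case: sM => -[aM /(_ s t st)[Y cY YM]]; exists Y => //.
  have MY : {ae P, forall w, M s w = Y w}.
    apply: ae_eq_of_le_integral YM _; [by have [] := aM s|by case: cY|].
    by rewrite (is_cond_exp_expectation cY) !Mc.
  by move: MY; apply: filterS.
apply: ae_eq_of_le_integral YM _; [by case: cY|by have [] := aM s|].
by rewrite (is_cond_exp_expectation cY) !Mc.
Qed.

Lemma expectation_between s r t (c : \bar R) :
  submartingale P F M \/ supermartingale P F M -> s <= r -> r <= t ->
  (\int[P]_w (M s w)%:E = c)%E -> (\int[P]_w (M t w)%:E = c)%E ->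
  (\int[P]_w (M r w)%:E = c)%E.
Proof.
move=> sM sr rt Ms Mt; apply/eqP; rewrite eq_le; apply/andP.
case: sM => sM; split.
- by rewrite -Mt; exact: submartingale_expectation.
- by rewrite -Ms; exact: submartingale_expectation.
- by rewrite -Ms; exact: supermartingale_expectation.
- by rewrite -Mt; exact: supermartingale_expectation.
Qed.

End constant_expectation.

(** * Limits in distribution of the constant 1 *)

(** The mean of clip 1 X is the limit of the means of clip 1 1 = 1. As clip 1 X
    lies below both X and the constant 1, and all three have mean 1, all three
    agree almost surely. *)
Lemma cvg_in_distribution_eq1 (R : realType)
    (dn : nat -> measure_display) (Tn : forall n, measurableType (dn n))
    (Pn : forall n, probability (Tn n) R) (Xn : forall n, {RV (Pn n) >-> R})
    (d : measure_display) (T : measurableType d) (P : probability T R)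
    (X : {RV P >-> R}) :
  P.-integrable setT (EFin \o X) -> {ae P, forall w, 0 <= X w} ->
  (\int[P]_w (X w)%:E = 1)%E ->
  (forall n, {ae Pn n, forall w, Xn n w = 1}) -> cvg_in_distribution Xn X ->
  {ae P, forall w, X w = 1}.
Proof.
move=> iX X0 X1 Xn1 XnX.
have int1 : (\int[P]_w 1%:E = 1)%E.
  by rewrite integral_cst// mul1e; exact: probability_setT.
have clip1 : (\int[P]_w (clip 1 (X w))%:E = 1)%E.
  apply: (cvg_unique _ (cvg_in_distribution_clip_integral (k := 1) XnX)) => //.
  apply: cvg_near_cst; apply: nearW => n.
  transitivity (\int[Pn n]_w 1%:E)%E.
    apply: ae_eq_integral => //; first exact: measurable_clip_comp.
    move: (Xn1 n); apply: filterS => w -> _.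
    by rewrite clip_id// ler01 lexx.
  by rewrite integral_cst// mul1e; exact: probability_setT.
have ic := clip_integrable 1 iX.
have cX : {ae P, forall w, clip 1 (X w) = X w}.
  apply: ae_eq_of_le_integral => //; last by rewrite clip1.
  by move: X0; apply: filterS => w; exact: clip_le.
have c1 : {ae P, forall w, clip 1 (X w) = 1}.
  apply: ae_eq_of_le_integral => //; last by rewrite clip1.
    exact: finite_measure_integrable_cst.
  by apply: aeW => w; apply: clip_le_bound.
by move: cX c1; apply: filterS2 => w cXw c1w; rewrite -cXw.
Qed.

(** * The characterization *)

Theorem theorem1 (R : realType) :
  (* (1) *)
  (forall (d : measure_display) (T : measurableType d) (P : probability T R)
      (F : {nonneg R} -> set_system T) (M : {nonneg R} -> {RV P >-> R})
      (dn : nat -> measure_display) (Tn : forall n, measurableType (dn n))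
      (Pn : forall n, probability (Tn n) R)
      (Fn : forall n, {nonneg R} -> set_system (Tn n))
      (Mn : forall n, {nonneg R} -> {RV (Pn n) >-> R})
      (t : nat -> {nonneg R}) (Q : forall n, nat -> probability (Tn n) R),
    filtration F ->
    submartingale P F M \/ supermartingale P F M ->
    (forall s, {ae P, forall w, 0 <= M s w}) ->
    (forall n, filtration (Fn n)) ->
    (forall n, martingale (Pn n) (Fn n) (Mn n)) ->
    (forall n s, {ae Pn n, forall w, 0 <= Mn n s w}) ->
    (forall n, {ae Pn n, forall w, Mn n 0%:nng w = 1}) ->
    t 0%N = 0%:nng ->
    (t m)%:num @[m --> \oo] --> +oo ->
    (forall m, cvg_in_distribution (fun n => Mn n (t m)) (M (t m))) ->
    (forall n m, has_density (Pn n) (Q n m) (Mn n (t m))) ->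
    (martingale P F M /\ {ae P, forall w, M 0%:nng w = 1} <->
      forall m,
        ereal_sup (range (fun n => Q n m [set w | kappa <= Mn n (t m) w]))
          @[kappa --> +oo] --> 0%E) /\
    (martingale P F M /\ {ae P, forall w, M 0%:nng w = 1} <->
      forall m, tight (fun n => Q n m) (fun n => Mn n (t m)))) /\
  (* (2) *)
  (forall (d : measure_display) (T : measurableType d) (P : probability T R)
      (Moo : {RV P >-> R})
      (dn : nat -> measure_display) (Tn : forall n, measurableType (dn n))
      (Pn : forall n, probability (Tn n) R)
      (Mnoo : forall n, {RV (Pn n) >-> R})
      (Q : forall n, probability (Tn n) R),
    {ae P, forall w, 0 <= Moo w} ->
    (forall n, {ae Pn n, forall w, 0 <= Mnoo n w}) ->
    (forall n, 'E_(Pn n)[Mnoo n] = 1)%E ->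
    cvg_in_distribution Mnoo Moo ->
    (forall n, has_density (Pn n) (Q n) (Mnoo n)) ->
    ('E_P[Moo] = 1)%E <->
      ereal_sup (range (fun n => Q n [set w | kappa <= Mnoo n w]))
        @[kappa --> +oo] --> 0%E).
Proof.
split; last first.
  move=> d T P Moo dn Tn Pn Mnoo Q M0 Mn0 _ MnM QM.
  rewrite expectation_def (ereal_sup_tail_cvg0P Q Mnoo).
  exact: expectation_eq1P.
move=> d T P F M dn Tn Pn Fn Mn t Q filF sM M0 _ _ Mn0 Mn1 t0 t_oo MnM QM.
(* Both tail conditions are uniform tails at each time t m. *)
suff H : martingale P F M /\ {ae P, forall w, M 0%:nng w = 1} <->
    forall m, uniform_tails (fun n => Q n m) (fun n => Mn n (t m)).
  split; rewrite H; split=> + m => /(_ m).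
  - by move/(ereal_sup_tail_cvg0P (fun n => Q n m) (fun n => Mn n (t m))).
  - by move/(ereal_sup_tail_cvg0P (fun n => Q n m) (fun n => Mn n (t m))).
  - by move/(tightP (fun n => Mn0 n (t m)) (fun n => @QM n m)).
  - by move/(tightP (fun n => Mn0 n (t m)) (fun n => @QM n m)).
have E1P m : (\int[P]_w (M (t m) w)%:E = 1)%E <->
    uniform_tails (fun n => Q n m) (fun n => Mn n (t m)).
  exact: (expectation_eq1P (fun n => Mn0 n (t m)) (fun n => @QM n m)).
split=> [[mM M1] m|ut].
  apply/E1P; rewrite -(martingale_expectation filF (s := 0%:nng) mM).
    transitivity (\int[P]_w 1%:E)%E.
      apply: ae_eq_integral => //; first exact/measurable_EFinP.
      by move: M1; apply: filterS => w ->.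
    by rewrite integral_cst// mul1e; exact: probability_setT.
  by rewrite -num_le/=.
have Et m : (\int[P]_w (M (t m) w)%:E = 1)%E by exact/E1P.
split.
  apply: (martingale_of_expectation filF sM (c := 1%E)) => s.
  have [m sm] : exists m, s <= t m.
    have /cvgryPge/(_ s%:num)/filter_ex[m sm] := t_oo.
    by exists m; rewrite -num_le.
  apply: (expectation_between filF sM _ sm (s := t 0%N)) => //.
  by rewrite t0 -num_le/=.
(* Stated for every s equal to t 0, because the two zeros of {nonneg R} at hand
   have the same value without being the same term. *)
have M1 (s : {nonneg R}) : s = t 0%N -> {ae P, forall w, M s w = 1}.
  move=> ->; apply: (cvg_in_distribution_eq1 _ (M0 _) (Et 0%N) _ (MnM 0%N)).
    by case: sM => -[/(_ (t 0%N))[]].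
  by rewrite t0.
by apply: M1; apply/val_inj; rewrite t0.
Qed.
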